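(* If $M_1^{n_1},M_2^{n_2}\subset\mathbf{R}^N$ are a totally skew pair of closed submanifolds (of dimensions $n_1$ and $n_2$ respectively), then $N\ge n_1+n_2+2$.
   Context: Closed means compact, connected, and without boundary. A pair of lines in $\mathbf{R}^N$ is skew if they are not parallel and do not intersect. Two affine subspaces $V,W\subset\mathbf{R}^N$ are skew if every pair of lines $\ell_1\subset V$, $\ell_2\subset W$ is skew. Submanifolds $M_1,M_2\subset\mathbf{R}^N$ are a totally skew pair if for every $x\in M_1$ and $y\in M_2$ the (affine) tangent spaces $T_xM_1$ and $T_yM_2$ are skew.
   Formalization: Both dimensions are assumed at least 1: a point has a tangent space containing no line, so it forms a totally skew pair vacuously with any closed submanifold, and a point with a circle in the plane would violate the bound. *)

(* Defs.v *)
From HB Require Import structures.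
From mathcomp Require Import all_boot all_order all_algebra.
From mathcomp Require Import all_classical all_reals all_analysis.

Set Implicit Arguments.
Unset Strict Implicit.
Unset Printing Implicit Defensive.

Import Order.TTheory GRing.Theory Num.Theory.
Import numFieldNormedType.Exports.

Local Open Scope classical_set_scope.
Local Open Scope ring_scope.

(* R^N is 'rV[R]_N. *)

Section Lines.
Context {R : realType} {N : nat}.
Implicit Types (a v : 'rV[R]_N) (L V W : set 'rV[R]_N).

Definition line a v : set 'rV[R]_N := [set a + t *: v | t in [set: R]].

Definition is_line L := exists a v, v != 0 /\ L = line a v.

Definition parallel_lines L1 L2 :=
  exists a1 a2 v, [/\ v != 0, L1 = line a1 v & L2 = line a2 v].

Definition skew_lines L1 L2 := ~ parallel_lines L1 L2 /\ ~ (L1 `&` L2 !=set0).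

Definition skew V W :=
  forall L1 L2, is_line L1 -> is_line L2 ->
    L1 `<=` V -> L2 `<=` W -> skew_lines L1 L2.

End Lines.

Section Submanifolds.
Context {R : realType} {N : nat}.

(* C^1 is the least regularity for which the tangent spaces make sense; every
   smoother submanifold is a C^1 submanifold with the same tangent spaces. *)
Definition C1_on (n : nat) (V : set 'rV[R]_n) (phi : 'rV[R]_n -> 'rV[R]_N) :=
  forall q, V q -> differentiable phi q /\ {for q, continuous (jacobian phi)}.

(* phi is a regular C^1 parametrization of M `&` U by the open set V; psi is
   its continuous inverse, so that M carries the subspace topology. *)
Definition local_parametrization (n : nat) (M U : set 'rV[R]_N)
    (V : set 'rV[R]_n) (phi : 'rV[R]_n -> 'rV[R]_N) :=
  [/\ C1_on V phi,
      forall q, V q -> injective ('d phi q),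
      phi @` V = M `&` U
    & exists psi : 'rV[R]_N -> 'rV[R]_n,
        (forall q, V q -> psi (phi q) = q) /\
        {within M `&` U, continuous psi}].

(* The sets V are open in R^n, not in a half-space: there is no boundary. *)
Definition submanifold (n : nat) (M : set 'rV[R]_N) :=
  forall p, M p ->
    exists (U : set 'rV[R]_N) (V : set 'rV[R]_n) (phi : 'rV[R]_n -> 'rV[R]_N),
      [/\ open U, U p, open V & local_parametrization M U V phi].

(* A connected manifold is nonempty, whereas `connected set0` holds. *)
Definition closed_submanifold (n : nat) (M : set 'rV[R]_N) :=
  [/\ submanifold n M, compact M, connected M & M !=set0].

(* Velocities at p of curves in M; for a C^1 submanifold these form the image
   of the differential of any local parametrization at p. *)
Definition tangent_vector (M : set 'rV[R]_N) (p v : 'rV[R]_N) :=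
  exists gamma : R -> 'rV[R]_N,
    [/\ gamma 0 = p, \forall t \near (0 : R), M (gamma t)
      & is_derive (0 : R) (1 : R) gamma v].

Definition affine_tangent_space (M : set 'rV[R]_N) (p : 'rV[R]_N) :
  set 'rV[R]_N := [set p + v | v in tangent_vector M p].

(* Vacuous when M1 or M2 is a point, whose tangent space contains no line. *)
Definition totally_skew_pair (M1 M2 : set 'rV[R]_N) :=
  forall x y, M1 x -> M2 y ->
    skew (affine_tangent_space M1 x) (affine_tangent_space M2 y).

End Submanifolds.

(* Main.v *)
(** Fix a nonzero linear functional [h] and suppose, after exchanging the two
    submanifolds if necessary, that [b] maximizes [h] on [M1] and that
    [h <= h b] on [M2]. Then [h] vanishes on [T_b M1]. Total skewness says that
    [T_x M1], [T_y M2] and [y - x] are linearly independent, so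
    [n1 + n2 + 1 <= N]; if equality held, these would span the whole space.
    Spanning forces [h < h b] on [M2], since at a point of [M2] of height [h b]
    the functional [h] would vanish on a spanning set. Hence, [T_b M1] having
    codimension at least two, one can pick a functional [k] vanishing on
    [T_b M1] and not proportional to [h], and maximize the central projection
    [k (y - b) / h (y - b)] over [y] in [M2]. At a maximizer [y] the functional
    [h (y - b) k - k (y - b) h] vanishes on [T_b M1], [T_y M2] and [y - b],
    so it is zero, contradicting the choice of [k]. *)
Require Import Defs.
From HB Require Import structures.
From mathcomp Require Import all_boot all_order all_algebra.
From mathcomp Require Import all_classical all_reals all_analysis.

Set Implicit Arguments.
Unset Strict Implicit.
Unset Printing Implicit Defensive.

Import Order.TTheory GRing.Theory Num.Theory.
Import numFieldNormedType.Exports.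

Local Open Scope classical_set_scope.
Local Open Scope ring_scope.

(** * Linear functionals and their maxima on a set *)

Section LinearFunctionals.
Context {R : realType} {N : nat}.
Implicit Types (M : set 'rV[R]_N) (p v : 'rV[R]_N) (u : 'cV[R]_N).

(** Functionals are column vectors, so [u] annihilates the row space of [D] exactly when
    [D *m u = 0]. *)
Definition lform u v : R := (v *m u) 0 0.

Lemma lformB u v w : lform u (v - w) = lform u v - lform u w.
Proof. by rewrite /lform mulmxBl !mxE. Qed.

Lemma lformN u v : lform u (- v) = - lform u v.
Proof. by rewrite /lform mulNmx mxE. Qed.

Lemma lformZ u a v : lform u (a *: v) = a * lform u v.
Proof. by rewrite /lform -scalemxAl mxE. Qed.

Lemma lform_comb u w a b v :
  lform (a *: u - b *: w) v = a * lform u v - b * lform w v.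
Proof. by rewrite /lform mulmxBr -!scalemxAr !mxE. Qed.

Lemma lform_eq0 u v : lform u v = 0 -> v *m u = 0.
Proof. by move=> uv0; apply/matrixP => i j; rewrite !ord1 [RHS]mxE. Qed.

Lemma lform_continuous u : continuous (lform u).
Proof.
rewrite [lform u](_ : _ = fun v => \sum_(i < N) v 0 i * u i 0); last first.
  by apply/funext => v; rewrite /lform mxE.
move=> v; have := @cvg_big _ _ +%R 0 xpredT (@add_continuous R) _ (nbhs v)
  (index_enum 'I_N) (fun i (w : 'rV_N) => w 0 i * u i 0)
  (fun i => v 0 i * u i 0) _; apply => i _.
by apply: cvgM; [exact: coord_continuous | exact: cvg_cst].
Qed.

(** Right-hand difference quotients along a curve leaving a maximum are nonpositive, and so is their
    limit. *)
Lemma tangent_vector_lform_le0 M p v u :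
  (forall x, M x -> lform u x <= lform u p) -> tangent_vector M p v ->
  lform u v <= 0.
Proof.
move=> pmax [g [g0 gM [dg gv]]].
have cvgv : lform u (h^-1 *: ((g \o shift 0) (h *: 1) - g 0)) @[h --> 0^'+]
    --> lform u v.
  apply: (@cvg_comp _ _ _ _ (lform u) _ (nbhs v)); last exact: lform_continuous.
  by apply: cvg_dnbhs_at_right; rewrite -gv; exact: dg.
have cvgM : \forall h \near 0^'+, M (g h) by apply: cvg_within; exact: gM.
rewrite -(cvg_lim _ cvgv) //.
apply: limr_le; first by apply/cvg_ex; eexists; exact: cvgv.
near=> h; rewrite lformZ lformB /= addr0 [_%:A]mulr1 g0.
rewrite pmulr_rle0 ?invr_gt0 ?subr_le0; first by apply: pmax; near: h.
by near: h; exact: nbhs_right_gt.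
Unshelve. all: by end_near. Qed.

End LinearFunctionals.

(** * Bases of tangent directions *)

Section TangentFrames.
Context {R : realType} {N : nat}.
Implicit Types (M : set 'rV[R]_N) (x y : 'rV[R]_N) (u : 'cV[R]_N).

(** Only the inclusion of the row space in the tangent vectors is recorded: it supplies [n]
    independent directions. *)
Definition tangent_frame n M x (D : 'M[R]_(n, N)) :=
  row_free D /\ forall c, tangent_vector M x (c *m D).

(** The Jacobian of a parametrization serves: [phi] maps the segment through [q] in direction [c] to
    a curve with velocity [c *m D]. *)
Lemma tangent_frame_exists n M x :
  submanifold n M -> M x -> exists D : 'M[R]_(n, N), tangent_frame M x D.
Proof.
move=> sM Mx; have [U [V [phi [_ Ux oV [C1phi inj_dphi phiV _]]]]] := sM x Mx.
have [q Vq phiq] : (phi @` V) x by rewrite phiV.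
have [dphi _] := C1phi q Vq.
exists (jacobian phi q); split=> [|c].
  apply: inj_row_free => v; rewrite -deriveEjacobian// deriveE// => dv0.
  by apply: (inj_dphi q Vq); rewrite dv0 linear0.
exists (fun t : R => phi (t *: c + q)); split.
- by rewrite scale0r add0r.
- have : (fun t : R => t *: c + q) @ 0 --> 0 *: c + q.
    by apply: cvgD; [exact: scalel_continuous | exact: cvg_cst].
  rewrite scale0r add0r => cvgq.
  have : \forall t \near (0 : R), V (t *: c + q).
    by apply: cvgq; exact: open_nbhs_nbhs.
  apply: filterS => t Vt.
  have [] // : (M `&` U) (phi (t *: c + q)).
  by rewrite -phiV; exists (t *: c + q).
- have /derivable1P dc : derivable phi q c by exact: diff_derivable.
  apply: DeriveDef => //; rewrite -deriveEjacobian// /derive.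
  set g := (fun _ : R => phi _); set dg := (fun _ : R => _).
  set dphic := (fun _ : R => _); suff -> : dg = dphic by [].
  by apply/funext => t; rewrite /dg /g /= addr0 [_%:A]mulr1 scale0r add0r.
Qed.

Lemma tangent_frame_max n M x (D : 'M[R]_(n, N)) u :
  tangent_frame M x D -> (forall z, M z -> lform u z <= lform u x) ->
  D *m u = 0.
Proof.
move=> [_ tD] xmax; apply/row_matrixP => i; rewrite row_mul row0.
(* Both a row and its opposite are tangent, which gives the two inequalities. *)
apply/lform_eq0/eqP; rewrite eq_le rowE.
rewrite (tangent_vector_lform_le0 xmax (tD _)) /= -oppr_le0 -lformN -mulNmx.
exact: tangent_vector_lform_le0 xmax (tD _).
Qed.

End TangentFrames.

(** * Total skewness as linear independence *)

Section Skew.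
Context {R : realType} {N : nat}.
Implicit Types (M : set 'rV[R]_N) (x y : 'rV[R]_N) (u : 'cV[R]_N).

Lemma totally_skew_pair_sym M1 M2 :
  totally_skew_pair M1 M2 -> totally_skew_pair M2 M1.
Proof.
move=> sk x y M2x M1y L1 L2 l1 l2 s1 s2.
have [np ni] := sk y x M1y M2x L2 L1 l2 l1 s2 s1; split.
- by move=> [a1 [a2 [v [v0 e1 e2]]]]; apply: np; exists a2, a1, v.
- by rewrite setIC.
Qed.

Lemma line_sub_tangent n M x (D : 'M[R]_(n, N)) c d :
  tangent_frame M x D ->
  line (x + c *m D) (d *m D) `<=` affine_tangent_space M x.
Proof.
move=> [_ tD] _ [t _ <-]; exists ((c + t *: d) *m D); first exact: tD.
by rewrite mulmxDl -scalemxAl addrA.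
Qed.

(** In a relation [c1 *m D1 + c2 *m D2 + s *: (y - x) = 0], a nonzero [s] makes the tangent spaces
    meet, while [s = 0] gives them a common direction unless the relation is trivial. *)
Lemma totally_skew_free n1 n2 M1 M2 x y (D1 : 'M[R]_(n1, N))
    (D2 : 'M[R]_(n2, N)) :
  (0 < n1)%N -> (0 < n2)%N -> totally_skew_pair M1 M2 -> M1 x -> M2 y ->
  tangent_frame M1 x D1 -> tangent_frame M2 y D2 ->
  row_free (col_mx (col_mx D1 D2) (y - x)).
Proof.
move=> n1_gt0 n2_gt0 sk M1x M2y tD1 tD2.
have inj n (D : 'M[R]_(n, N)) (c : 'rV_n) : row_free D -> c *m D = 0 -> c = 0.
  by move=> fD cD0; apply: (row_free_inj fD); rewrite mul0mx.
have nz n (D : 'M[R]_(n, N)) (c : 'rV_n) : row_free D -> c != 0 -> c *m D != 0.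
  by move=> fD; apply: contra_neq => /inj; exact.
have [/nz nz1 _] := tD1; have [/nz nz2 _] := tD2.
have skl c1 c2 d1 d2 : d1 *m D1 != 0 -> d2 *m D2 != 0 ->
    skew_lines (line (x + c1 *m D1) (d1 *m D1)) (line (y + c2 *m D2) (d2 *m D2)).
  move=> d10 d20; apply: (sk x y M1x M2y); try exact: line_sub_tangent.
  - by exists (x + c1 *m D1), (d1 *m D1).
  - by exists (y + c2 *m D2), (d2 *m D2).
apply: inj_row_free => v; rewrite -[v]hsubmxK -[lsubmx v]hsubmxK.
set c1 := lsubmx (lsubmx v); set c2 := rsubmx (lsubmx v); set s := rsubmx v.
rewrite !mul_row_col [s]mx11_scalar mul_scalar_mx; move: (s 0 0) => {s} s e.
have s0 : s = 0.
  apply/eqP/negP => /negP s0.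
  have one_neq0 n : (0 < n)%N -> const_mx 1 != 0 :> 'rV[R]_n.
    case: n => // n _; apply/eqP => /matrixP/(_ 0 0)/eqP.
    by rewrite !mxE oner_eq0.
  (* Dividing the relation by [s] shows that these base points coincide; the directions are
     arbitrary nonzero ones. *)
  have [_] := skl (- s^-1 *: c1) (s^-1 *: c2) _ _ (nz1 _ (one_neq0 _ n1_gt0))
    (nz2 _ (one_neq0 _ n2_gt0)); apply.
  have c2E : c2 *m D2 = s *: (x - y) - c1 *m D1.
    apply: (addrI (c1 *m D1)); rewrite [RHS]addrC subrK; apply/eqP.
    by rewrite -subr_eq0 -scalerN opprB e.
  exists (x + (- s^-1 *: c1) *m D1); split; exists 0 => //;
    rewrite scale0r addr0 //.
  by rewrite -!scalemxAl c2E scalerBr scalerK// scaleNr addrA addrCA subrr addr0.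
move: e; rewrite s0 scale0r addr0 => e.
have [c10|c10] := eqVneq c1 0.
  move: e; rewrite c10 mul0mx add0r => /inj -> //; last by case: tD2.
  by rewrite !raddf0 !row_mx0.
have c20 : c2 *m D2 != 0.
  apply/eqP => c20; move: e; rewrite c20 addr0; apply/eqP; exact: nz1.
have [np _] := skl 0 0 _ (- c2) (nz1 _ c10) ltac:(by rewrite mulNmx oppr_eq0).
case: np; exists (x + 0 *m D1), (y + 0 *m D2), (c1 *m D1); split => //.
  exact: nz1.
by rewrite mulNmx; congr line; apply/esym/eqP; rewrite -addr_eq0 e.
Qed.

(** The [n1 + n2 + 1] independent rows span the whole space, by the bound on [N]. *)
Lemma tangents_separate n1 n2 M1 M2 x y (D1 : 'M[R]_(n1, N))
    (D2 : 'M[R]_(n2, N)) u :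
  (0 < n1)%N -> (0 < n2)%N -> totally_skew_pair M1 M2 -> M1 x -> M2 y ->
  (N <= n1 + n2 + 1)%N -> tangent_frame M1 x D1 -> tangent_frame M2 y D2 ->
  D1 *m u = 0 -> D2 *m u = 0 -> lform u (y - x) = 0 -> u = 0.
Proof.
move=> n1_gt0 n2_gt0 sk M1x M2y leN tD1 tD2 u1 u2 /lform_eq0 u3.
have fA := totally_skew_free n1_gt0 n2_gt0 sk M1x M2y tD1 tD2.
have fullA : row_full (col_mx (col_mx D1 D2) (y - x)).
  by rewrite /row_full eqn_leq rank_leq_col (eqP fA).
by apply: (row_full_inj fullA); rewrite mulmx0 !mul_col_mx u1 u2 u3 !col_mx0.
Qed.

(** The annihilator of the rows of [D] has dimension at least two, so no single [u] spans it. *)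
Lemma second_functional n (D : 'M[R]_(n, N)) u :
  (n.+1 < N)%N -> exists2 k : 'cV[R]_N, D *m k = 0 & forall a, k <> a *: u.
Proof.
move=> ltnN; have /row_subPn[i ki] : ~~ (kermx D^T <= u^T)%MS.
  apply/negP => /mxrankS; rewrite mxrank_ker mxrank_tr leqNgt => /negP; apply.
  apply: leq_ltn_trans (rank_leq_row _) _; rewrite ltn_subRL addn1.
  by apply: leq_ltn_trans ltnN; rewrite ltnS rank_leq_row.
exists (row i (kermx D^T))^T.
  by apply: trmx_inj; rewrite trmx_mul trmxK -row_mul mulmx_ker row0 trmx0.
move=> a ka; move/negP: ki; apply; rewrite -[row _ _]trmxK ka linearZ.
exact: scalemx_sub.
Qed.

End Skew.

(** * The extremal argument *)

Section Outermost.
Context {R : realType} {N : nat}.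

(** Here [y] maximizes the ratio of [k] to [u]; both denominators are negative, so clearing them
    preserves the inequality. *)
Lemma compact_lform_ratio_max (M : set 'rV[R]_N) (b : 'rV[R]_N) (u k : 'cV[R]_N) :
  compact M -> M !=set0 -> (forall y, M y -> lform u (y - b) < 0) ->
  exists2 y, M y & forall z, M z ->
    lform u (y - b) * lform k (z - b) <= lform k (y - b) * lform u (z - b).
Proof.
move=> cM M0 ult0.
pose f (y : 'rV[R]_N) := lform k (y - b) / lform u (y - b).
have cB w : continuous (fun z : 'rV[R]_N => lform w (z - b)).
  have -> : (fun z : 'rV[R]_N => lform w (z - b)) =
      (fun z : 'rV[R]_N => lform w z - lform w b).
    by apply/funext => z; rewrite lformB.
  move=> y; apply: (@cvgB _ _ _ (nbhs y)); last exact: cvg_cst.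
  exact: lform_continuous.
have [y] : exists2 y, y \in M & forall z, z \in M -> f z <= f y.
  apply: compact_EVT_max => //; apply: continuous_in_subspaceT => y.
  rewrite inE => /ult0 /lt_eqF/negbT uy0.
  by apply: (@cvgM _ _ (nbhs y)); [exact: cB | apply: cvgV => //; exact: cB].
rewrite inE => My ymax; exists y => // z Mz.
have := ymax z; rewrite inE => /(_ Mz).
rewrite /f ler_ndivrMr ?ult0// mulrAC ler_ndivrMr ?ult0//.
by rewrite [X in X <= _]mulrC.
Qed.

(** This is the core contradiction, with [u] as the functional h and [M1] reaching at least as far
    as [M2]. *)
Lemma totally_skew_outer n1 n2 (M1 M2 : set 'rV[R]_N) b (u : 'cV[R]_N) :
  (0 < n1)%N -> (0 < n2)%N -> submanifold n1 M1 -> submanifold n2 M2 ->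
  compact M2 -> M2 !=set0 -> totally_skew_pair M1 M2 ->
  (N <= n1 + n2 + 1)%N -> u != 0 -> M1 b ->
  (forall x, M1 x -> lform u x <= lform u b) ->
  ~ (forall y, M2 y -> lform u y <= lform u b).
Proof.
move=> n1_gt0 n2_gt0 sM1 sM2 cM2 M20 sk leN u0 M1b bmax bmax2.
have [D1 tD1] := tangent_frame_exists sM1 M1b.
have u1 : D1 *m u = 0 := tangent_frame_max tD1 bmax.
have sep y (D2 : 'M[R]_(n2, N)) w : M2 y -> tangent_frame M2 y D2 ->
    D1 *m w = 0 -> D2 *m w = 0 -> lform w (y - b) = 0 -> w = 0.
  by move=> M2y; exact: tangents_separate n1_gt0 n2_gt0 sk M1b M2y leN tD1.
have ult0 y : M2 y -> lform u (y - b) < 0.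
  move=> M2y; rewrite lformB subr_lt0 lt_neqAle bmax2// andbT.
  apply/negP => /eqP uyb; have [D2 tD2] := tangent_frame_exists sM2 M2y.
  move/eqP: u0; apply; apply: (sep _ _ _ M2y tD2) => //; last first.
    by rewrite lformB uyb subrr.
  by apply: (tangent_frame_max tD2) => z M2z; rewrite uyb bmax2.
have ltN : (n1.+1 < N)%N.
  have [y M2y] := M20; have [D2 tD2] := tangent_frame_exists sM2 M2y.
  have := rank_leq_col (col_mx (col_mx D1 D2) (y - b)).
  rewrite (eqP (totally_skew_free n1_gt0 n2_gt0 sk M1b M2y tD1 tD2)).
  apply: leq_trans; rewrite addn1 ltnS -[X in (X < _)%N]addn0 ltn_add2l.
  exact: n2_gt0.
have [k k1 kNu] := second_functional D1 u ltN.
have [y M2y ymax] := compact_lform_ratio_max k cM2 M20 ult0.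
have [D2 tD2] := tangent_frame_exists sM2 M2y.
(* By the choice of [y], [w] is nonpositive on [z - b] for [z] in [M2] and zero on [y - b], so [y]
   maximizes [w] on [M2]. *)
pose w := lform u (y - b) *: k - lform k (y - b) *: u.
have wy : lform w (y - b) = 0 by rewrite lform_comb mulrC subrr.
have w0 : w = 0.
  apply: (sep _ _ _ M2y tD2) => //.
    by rewrite mulmxBr -!scalemxAr k1 u1 !scaler0 subrr.
  apply: (tangent_frame_max tD2) => z M2z.
  rewrite -[leRHS](subrK (lform w b)) -lformB wy add0r -subr_le0.
  by rewrite -lformB lform_comb subr_le0 ymax.
apply: (kNu ((lform u (y - b))^-1 * lform k (y - b))).
move/eqP: w0; rewrite subr_eq0 -scalerA => /eqP <-.
by rewrite scalerK// lt_eqF// ult0.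
Qed.

Lemma compact_lform_max (M : set 'rV[R]_N) (u : 'cV[R]_N) :
  compact M -> M !=set0 ->
  exists2 b, M b & forall x, M x -> lform u x <= lform u b.
Proof.
move=> cM M0; have [b] := compact_EVT_max M0 cM
  (continuous_subspaceT (@lform_continuous _ _ u)).
rewrite inE => Mb bmax; exists b => // x Mx; apply: bmax; exact: mem_set.
Qed.

End Outermost.

Theorem theorem6p2 (R : realType) (N n1 n2 : nat) (M1 M2 : set 'rV[R]_N)
    (n1_gt0 : (0 < n1)%N) (n2_gt0 : (0 < n2)%N)
    (hM1 : closed_submanifold n1 M1) (hM2 : closed_submanifold n2 M2)
    (hskew : totally_skew_pair M1 M2) :
  (n1 + n2 + 2 <= N)%N.
Proof.
have [sM1 cM1 _ M10] := hM1; have [sM2 cM2 _ M20] := hM2.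
rewrite leqNgt addn2 ltnS -addn1; apply/negP => leN.
(* Any nonzero functional would do; this one is nonzero because a tangent frame forces [N > 0]. *)
pose u : 'cV[R]_N := const_mx 1.
have u0 : u != 0.
  have [x M1x] := M10; have [D [/eqP fD _]] := tangent_frame_exists sM1 M1x.
  have N_gt0 : (0 < N)%N by rewrite (leq_trans n1_gt0)// -fD rank_leq_col.
  apply/eqP => /matrixP/(_ (Ordinal N_gt0) 0)/eqP.
  by rewrite !mxE oner_eq0.
have [b1 M1b b1max] := compact_lform_max u cM1 M10.
have [b2 M2b b2max] := compact_lform_max u cM2 M20.
(* The submanifold with the larger maximum takes the role of [M1]. *)
have [le21|/ltW le12] := leP (lform u b2) (lform u b1).
  apply: (totally_skew_outer _ _ sM1 sM2 cM2 M20 hskew leN u0 M1b b1max) => //.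
  by move=> y /b2max /le_trans; exact.
rewrite [(n1 + n2)%N]addnC in leN.
apply: (totally_skew_outer _ _ sM2 sM1 cM1 M10 (totally_skew_pair_sym hskew)
  leN u0 M2b b2max) => //.
by move=> x /b1max /le_trans; exact.
Qed.
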